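(* Assume that $\Omega$ satisfies the Boundary Regularity Condition with constants $r_0,s\in(0,1)$. Let $y\in\partial\Omega$, $r\in(0,r_0]$, and let $B_{sr}(z)\subset B_r(y)\setminus\Omega$ be the ball given by the Boundary Regularity Condition. Let $u=u_\varepsilon$ be the solution of the dynamic programming principle $u=T_\varepsilon u$ on $\overline\Omega_\varepsilon$ with continuous boundary data $F$. Then for all $\eta>0$ there exist $\varepsilon_0\in(0,1)$ and an integer $k\ge1$ such that $$u_\varepsilon(x_0)-\sup_{B_{4r}(z)\cap\Gamma_{\varepsilon,\varepsilon}}F<\eta$$ for all $0<\varepsilon<\varepsilon_0$ and all $x_0\in B_{4^{1-k}r}(y)\cap\overline\Omega_\varepsilon$.
   Context: $n\ge 2$ is an integer and $\Omega\subset\mathbb R^n$ is a bounded domain. For $\varepsilon>0$ put $I_\varepsilon=\{x\in\Omega:\operatorname{dist}(x,\partial\Omega)<\varepsilon\}$, $O_\varepsilon=\{x\in\mathbb R^n\setminus\overline\Omega:\operatorname{dist}(x,\partial\Omega)<\varepsilon\}$, $\Omega_\varepsilon=\overline\Omega\cup O_\varepsilon$, $\overline\Omega_\varepsilon$ its closure, and $\Gamma_{\varepsilon,\varepsilon}=\overline{I_\varepsilon}\cup\overline{O_\varepsilon}$. $F:\Gamma_{1,1}\to\mathbb R$ is a fixed continuous function, and for $\varepsilon<1$ its restriction to $\Gamma_{\varepsilon,\varepsilon}\subset\Gamma_{1,1}$ is used. Let $\delta:\overline\Omega_\varepsilon\to[0,1]$ be $\delta(x)=0$ for $x\in\Omega\setminus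 I_\varepsilon$, $\delta(x)=1-\varepsilon^{-1}\operatorname{dist}(x,\partial\Omega)$ for $x\in I_\varepsilon$, and $\delta(x)=1$ for $x\in\overline{O_\varepsilon}\cup\partial\Omega$. Let $p:\overline\Omega\to\mathbb R$ be continuous with $1<\inf_\Omega p\le\sup_\Omega p<\infty$, and set $\alpha(x)=\frac{p(x)-1}{p(x)+n}$, $\beta(x)=1-\alpha(x)=\frac{n+1}{p(x)+n}$ for $x\in\overline\Omega$. For $\nu\ne0$ let $B_\varepsilon^\nu=\{z\in\mathbb R^n:|z|<\varepsilon,\ \langle z,\nu\rangle=0\}$, let $\mathcal L^{n-1}$ be $(n-1)$-dimensional Lebesgue measure, and put $$W(u;x,\nu)=\alpha(x)u(x+\nu)+\beta(x)\frac1{\mathcal L^{n-1}(B_\varepsilon^\nu)}\int_{B_\varepsilon^\nu}u(x+h)\,d\mathcal L^{n-1}(h),$$ $$T_\varepsilon u(x)=\frac{1-\delta(x)}2\Big[\sup_{|\nu|=\varepsilon}W(u;x,\nu)+\inf_{|\nu|=\varepsilon}W(u;x,\nu)\Big]+\delta(x)F(x),$$ with the conventions $T_\varepsilon u(x)=F(x)$ for $x\in\overline\Omega_\varepsilon\setminus\overline\Omega$ and $\delta(x)F(x)=0$ for $x\in\Omega\setminus I_\varepsilon$. For each $\varepsilon$ there is a unique continuous $u_\varepsilon:\overline\Omega_\varepsilon\to\mathbb R$ with $u_\varepsilon=T_\varepsilon u_\varepsilon$; this is ''the solution''. Boundary Regularity Condition: there are universal constants $r_0,s\in(0,1)$ such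 that for all $r\in(0,r_0]$ and $y\in\partial\Omega$ there exists a ball $B_{sr}(z)\subset B_r(y)\setminus\Omega$ for some $z\in B_r(y)\setminus\Omega$. Here $B_\rho(w)$ is the open ball of radius $\rho$ centred at $w$ in $\mathbb R^n$. *)

(* Defs.v *)
From HB Require Import structures.
From mathcomp Require Import all_boot all_order all_algebra.
From mathcomp Require Import all_classical all_reals all_analysis.
From mathcomp Require Import ring lra.

Set Implicit Arguments.
Unset Strict Implicit.
Unset Printing Implicit Defensive.

Import Order.TTheory GRing.Theory Num.Theory.
Import numFieldNormedType.Exports.

Local Open Scope classical_set_scope.
Local Open Scope ring_scope.

(* The library norm of 'rV[R]_n is the sup norm. It induces the usual topology
   and the usual bounded sets, so it is only used for these; every metric
   notion below (spheres, balls, distances) is Euclidean. *)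

Definition edot (R : realType) (n : nat) (u v : 'rV[R]_n) : R :=
  \sum_(i < n) u 0 i * v 0 i.

Definition enorm (R : realType) (n : nat) (u : 'rV[R]_n) : R :=
  Num.sqrt (edot u u).

Definition eball (R : realType) (n : nat) (x : 'rV[R]_n) (r : R) :
  set 'rV[R]_n := [set y | enorm (y - x) < r].

Definition dist (R : realType) (n : nat) (x : 'rV[R]_n) (A : set 'rV[R]_n) : R :=
  inf [set enorm (x - y) | y in A].

Definition bdry (T : topologicalType) (A : set T) : set T :=
  closure A `\` interior A.

Definition bounded_domain (R : realType) (n : nat) (Omega : set 'rV[R]_n) :
  Prop :=
  [/\ Omega !=set0, open Omega, connected Omega & bounded_set Omega].

Section lebesgue_tuple.
Context {R : realType}.
Local Notation mR := (measurableTypeR R).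

Definition tcons (m : nat) (x : mR * m.-tuple mR) : m.+1.-tuple mR :=
  [tuple of x.1 :: x.2].

Lemma measurable_tcons (m : nat) : measurable_fun setT (@tcons m).
Proof.
exact: (@measurable_cons _ _ _ mR fst m snd).
Qed.

Definition lebesgue_step (m : nat)
    (mu : {sigma_finite_measure set (m.-tuple mR) -> \bar R}) :=
  pushforward (@lebesgue_measure R \x mu)%E (@tcons m).

Section step.
Variables (m : nat) (mu : {sigma_finite_measure set (m.-tuple mR) -> \bar R}).

Let nu0 : lebesgue_step mu set0 = 0%E.
Proof. by rewrite /lebesgue_step/pushforward preimage_set0 measure0. Qed.

Let nu_ge0 A : (0 <= lebesgue_step mu A)%E.
Proof. by rewrite /lebesgue_step/pushforward measure_ge0. Qed.

Let nu_sigma_additive : semi_sigma_additive (lebesgue_step mu).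
Proof.
move=> F mF tF mUF; rewrite /lebesgue_step/pushforward preimage_bigcup.
apply: measure_semi_sigma_additive.
- by move=> k; rewrite -[X in measurable X]setTI; exact: measurable_tcons.
- apply/trivIsetP => /= i j _ _ ij; rewrite -preimage_setI.
  by move/trivIsetP : tF => /(_ _ _ _ _ ij) ->//; rewrite preimage_set0.
- by rewrite -preimage_bigcup -[X in measurable X]setTI; exact: measurable_tcons.
Qed.

HB.instance Definition _ := isMeasure.Build _ _ _ (lebesgue_step mu)
  nu0 nu_ge0 nu_sigma_additive.

Let nu_sigma_finite : sigma_finite setT (lebesgue_step mu).
Proof.
have /sigma_finiteP[F [TF ndF Foo]] := sigma_finiteT (@lebesgue_measure R).
have /sigma_finiteP[G [TG ndG Goo]] := sigma_finiteT mu.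
have [H UH mH] : sigma_finite setT (@lebesgue_measure R \x mu)%E.
  exists (fun k => F k `*` G k).
    rewrite -setXTT TF TG predeqE => -[x y]; split.
      move=> [/= [k _ Fkx] [l _ Gly]]; exists (maxn k l) => //; split.
      - by move: x Fkx; exact/subsetPset/ndF/leq_maxl.
      - by move: y Gly; exact/subsetPset/ndG/leq_maxr.
    by move=> [k _ []/= ? ?]; split; exists k.
  move=> k; have [? ?] := Foo k; have [? ?] := Goo k.
  split; first exact: measurableX.
  by rewrite product_measure1E// lte_mul_pinfty// ge0_fin_numE.
pose g (t : m.+1.-tuple mR) : mR * m.-tuple mR :=
  (tnth t ord0, [tuple of behead t]).
have mg : measurable_fun setT g.
  apply/measurable_fun_pairP; split => /=.
    exact: (@measurable_tnth _ mR m.+1 ord0).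
  exact: (@measurable_behead _ mR m).
have gK x : g (tcons x) = x.
  by case: x => a t; rewrite /g /tcons/=; congr pair; exact/val_inj.
exists (fun i => g @^-1` H i) => [|i].
  by rewrite -preimage_bigcup -UH preimage_setT.
split; first by rewrite -[X in measurable X]setTI; apply: mg => //; exact: (mH i).1.
rewrite /lebesgue_step /pushforward (_ : _ @^-1` _ = H i); first exact: (mH i).2.
by apply/seteqP; split => x /=; rewrite gK.
Qed.

HB.instance Definition _ := Measure_isSigmaFinite.Build _ _ _ (lebesgue_step mu)
  nu_sigma_finite.
End step.

Fixpoint lebesgue_tuple (m : nat) :
    {sigma_finite_measure set (m.-tuple mR) -> \bar R} :=
  if m is m'.+1 then lebesgue_step (lebesgue_tuple m')
  else dirac ([tuple] : 0.-tuple mR).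

End lebesgue_tuple.

(* Isometric parametrization of the hyperplane orthogonal to nu: the rows of a
   frame are an orthonormal basis of it. *)
Definition is_frame (R : realType) (n : nat) (nu : 'rV[R]_n)
    (A : 'M[R]_(n.-1, n)) : Prop :=
  A *m A^T = 1%:M /\ A *m nu^T = 0.

Definition frame (R : realType) (n : nat) (nu : 'rV[R]_n) : 'M[R]_(n.-1, n) :=
  xget 0 [set A | is_frame nu A].

(* The frame is the image of the last basis vectors under the Householder
   reflection exchanging the first one and nu / |nu|. *)
Lemma frameP (R : realType) (n : nat) (nu : 'rV[R]_n) :
  nu != 0 -> is_frame nu (frame nu).
Proof.
case: n nu => [|m] nu nu0; first by rewrite thinmx0 eqxx in nu0.
rewrite /frame; suff [A hA] : exists A, is_frame nu A by case: xgetP => // /(_ A).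
have dotE (u v : 'rV[R]_m.+1) : u *m v^T = (edot u v)%:M.
  by apply/matrixP => i j; rewrite !ord1 !mxE mulr1n; apply: eq_bigr => k _; rewrite !mxE.
have dotBl (u v w : 'rV[R]_m.+1) : edot (u - v) w = edot u w - edot v w.
  by rewrite -sumrB; apply: eq_bigr => k _; rewrite !mxE mulrBl.
have dotC (u v : 'rV[R]_m.+1) : edot u v = edot v u.
  by apply: eq_bigr => k _; rewrite mulrC.
have dot_ge0 (u : 'rV[R]_m.+1) : 0 <= edot u u.
  by apply: sumr_ge0 => k _; rewrite -expr2 sqr_ge0.
have dot_eq0 (u : 'rV[R]_m.+1) : (edot u u == 0) = (u == 0).
  apply/idP/eqP => [|->]; last by rewrite /edot big1// => k _; rewrite !mxE mul0r.
  rewrite psumr_eq0 => [/allP u0|k _]; last by rewrite -expr2 sqr_ge0.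
  apply/rowP => k; have := u0 k (mem_index_enum k).
  by rewrite /= mulf_eq0 orbb mxE => /eqP.
pose v := (enorm nu)^-1 *: nu; pose e : 'rV[R]_m.+1 := delta_mx 0 0.
have enu0 : enorm nu != 0.
  by rewrite sqrtr_eq0 -ltNge lt_def dot_eq0 nu0 dot_ge0.
have nuE : nu = enorm nu *: v by rewrite scalerA divff// scale1r.
have vv : edot v v = 1.
  have -> : edot v v = (enorm nu)^-2 * edot nu nu.
    rewrite /edot mulr_sumr; apply: eq_bigr => k _; rewrite !mxE.
    by rewrite expr2 invfM mulrACA.
  by rewrite -[edot nu nu]sqr_sqrtr// mulVf// expf_neq0.
have ee : edot e e = 1.
  rewrite /edot (bigD1 ord0)//= big1 ?addr0 ?mxE ?eqxx ?mulr1// => k k0.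
  by rewrite !mxE (negbTE k0) andbF mulr0.
have [w wE] : exists w, w = v - e by exists (v - e).
have ww : edot w w = - 2 * edot e w.
  rewrite wE dotBl (dotC v) (dotC e) !dotBl vv ee (dotC v e); ring.
have [S [SS eS]] : exists S : 'M[R]_m.+1, S *m S^T = 1%:M /\ e *m S = v.
  have [w0|w0] := eqVneq w 0.
    exists 1%:M; rewrite trmx1 !mulmx1; split=> //.
    by apply/esym/eqP; rewrite -subr_eq0 -wE w0.
  pose c := 2 / edot w w.
  have cw : c * edot w w = 2 by rewrite /c divfK ?dot_eq0.
  exists (1%:M - c *: (w^T *m w)).
  have Wt : (w^T *m w)^T = w^T *m w by rewrite trmx_mul trmxK.
  have WW : (w^T *m w) *m (w^T *m w) = edot w w *: (w^T *m w).
    by rewrite mulmxA -(mulmxA w^T) dotE mul_mx_scalar -scalemxAl.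
  split.
    rewrite [X in _ *m X](_ : _ = 1%:M - c *: (w^T *m w)).
      rewrite mulmxBl mul1mx mulmxBr mulmx1.
      rewrite -scalemxAl -scalemxAr WW !scalerA -mulrA cw.
      by rewrite -scalerBl -addrA -opprD -scalerDl (_ : c + _ = 0) ?scale0r ?subr0//; ring.
    by rewrite linearB/= linearZ/= trmx1 Wt.
  rewrite mulmxBr mulmx1 -scalemxAr mulmxA dotE mul_scalar_mx scalerA.
  have -> : c * edot e w = -1 by move: cw; rewrite ww => h; lra.
  by rewrite scaleN1r opprK wE addrC subrK.
have PP : row' ord0 (1%:M : 'M[R]_m.+1) *m (row' ord0 1%:M)^T = 1%:M.
  rewrite tr_row' trmx1 -[X in _ *m X]mul1mx.
  apply/matrixP => i j; rewrite !mxE (bigD1 (lift ord0 i))//= big1.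
    rewrite !mxE eqxx mul1r addr0 (bigD1 (lift ord0 i))//= big1.
      by rewrite !mxE eqxx mul1r addr0 (inj_eq lift_inj).
    by move=> k ki; rewrite !mxE eq_sym (negbTE ki) mul0r.
  by move=> k ki; rewrite !mxE eq_sym (negbTE ki) mul0r.
exists (row' ord0 1%:M *m S); split.
  by rewrite trmx_mul mulmxA -(mulmxA _ S) SS mulmx1.
rewrite nuE linearZ/= -scalemxAr -eS trmx_mul mulmxA -(mulmxA _ S) SS mulmx1.
rewrite (_ : _ *m _ = 0) ?scaler0//.
apply/colP => i; rewrite !mxE big1// => k _; rewrite !mxE.
by have [<-|] := eqVneq (lift ord0 i) k; rewrite ?mul0r//= mulr0.
Qed.

Definition hyperplane_pt (R : realType) (n : nat) (nu : 'rV[R]_n)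
    (t : n.-1.-tuple (measurableTypeR R)) : 'rV[R]_n :=
  (\row_i tnth t i) *m frame nu.

(* The (n-1)-dimensional Lebesgue measure on the hyperplane orthogonal to nu,
   transported from R^(n-1) by the isometry hyperplane_pt, and the integral
   against it. By rotation invariance they do not depend on the frame. *)
Definition hyperplane_measure (R : realType) (n : nat) (nu : 'rV[R]_n)
    (E : set 'rV[R]_n) : \bar R :=
  lebesgue_tuple n.-1 (hyperplane_pt nu @^-1` E).

Definition hyperplane_integral (R : realType) (n : nat) (nu : 'rV[R]_n)
    (E : set 'rV[R]_n) (f : 'rV[R]_n -> R) : R :=
  \int[lebesgue_tuple n.-1]_(t in hyperplane_pt nu @^-1` E)
    f (hyperplane_pt nu t).

Definition hball (R : realType) (n : nat) (eps : R) (nu : 'rV[R]_n) :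
  set 'rV[R]_n := [set z | enorm z < eps /\ edot z nu = 0].

Definition inner_strip (R : realType) (n : nat) (Omega : set 'rV[R]_n)
    (eps : R) : set 'rV[R]_n :=
  [set x | Omega x /\ dist x (bdry Omega) < eps].

Definition outer_strip (R : realType) (n : nat) (Omega : set 'rV[R]_n)
    (eps : R) : set 'rV[R]_n :=
  [set x | ~ closure Omega x /\ dist x (bdry Omega) < eps].

Definition enlarged (R : realType) (n : nat) (Omega : set 'rV[R]_n)
    (eps : R) : set 'rV[R]_n :=
  closure Omega `|` outer_strip Omega eps.

Definition Gamma (R : realType) (n : nat) (Omega : set 'rV[R]_n)
    (eps : R) : set 'rV[R]_n :=
  closure (inner_strip Omega eps) `|` closure (outer_strip Omega eps).

(* On closure (enlarged Omega eps) the last case is exactly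
   closure (outer_strip Omega eps) `|` bdry Omega. *)
Definition delta (R : realType) (n : nat) (Omega : set 'rV[R]_n) (eps : R)
    (x : 'rV[R]_n) : R :=
  if x \in Omega `\` inner_strip Omega eps then 0
  else if x \in inner_strip Omega eps then
    1 - eps^-1 * dist x (bdry Omega)
  else 1.

Definition alpha (R : realType) (n : nat) (p : 'rV[R]_n -> R) (x : 'rV[R]_n) :
  R := (p x - 1) / (p x + n%:R).

Definition beta (R : realType) (n : nat) (p : 'rV[R]_n -> R) (x : 'rV[R]_n) :
  R := 1 - alpha p x.

Definition W (R : realType) (n : nat) (p : 'rV[R]_n -> R) (eps : R)
    (u : 'rV[R]_n -> R) (x nu : 'rV[R]_n) : R :=
  alpha p x * u (x + nu)
  + beta p x * ((fine (hyperplane_measure nu (hball eps nu)))^-1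
                * hyperplane_integral nu (hball eps nu) (fun h => u (x + h))).

(* F and p are total functions, of which only the values on Gamma Omega 1 and
   on closure Omega matter: where F is not meant to be defined, it is
   multiplied by delta Omega eps x = 0. *)
Definition dpp_operator (R : realType) (n : nat) (Omega : set 'rV[R]_n)
    (p F : 'rV[R]_n -> R) (eps : R) (u : 'rV[R]_n -> R) (x : 'rV[R]_n) : R :=
  if x \in closure Omega then
    (1 - delta Omega eps x) / 2
      * (sup [set W p eps u x nu | nu in [set nu | enorm nu = eps]]
         + inf [set W p eps u x nu | nu in [set nu | enorm nu = eps]])
    + delta Omega eps x * F x
  else F x.

Definition is_dpp_solution (R : realType) (n : nat) (Omega : set 'rV[R]_n)
    (p F : 'rV[R]_n -> R) (eps : R) (u : 'rV[R]_n -> R) : Prop :=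
  {within closure (enlarged Omega eps), continuous u} /\
  forall x, closure (enlarged Omega eps) x ->
    u x = dpp_operator Omega p F eps u x.

Definition regularity_ball (R : realType) (n : nat) (Omega : set 'rV[R]_n)
    (s r : R) (y z : 'rV[R]_n) : Prop :=
  (eball y r `\` Omega) z /\ eball z (s * r) `<=` eball y r `\` Omega.

Definition boundary_regularity (R : realType) (n : nat)
    (Omega : set 'rV[R]_n) (r0 s : R) : Prop :=
  forall r y, 0 < r <= r0 -> bdry Omega y ->
    exists z, regularity_ball Omega s r y z.

(* Main.v *)
Require Import Defs.
From mathcomp Require Import all_boot all_order all_algebra.
From mathcomp Require Import all_classical all_reals all_analysis.
From mathcomp Require Import measurable_realfun ring lra.

Import Order.TTheory GRing.Theory Num.Theory.
Import numFieldNormedType.Exports.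

Local Open Scope classical_set_scope.
Local Open Scope ring_scope.

(** The estimate is an iterated barrier argument. Let [z] be the centre of an exterior
    ball of radius [sig] and let [v = M + k ((sig/2)^(-2N) - |x - z|^(-2N))]. At a point
    [x] of [Omega], the supremum over [nu] is bounded using only [|x + nu - z| <= d + eps],
    where [d = |x - z|], and the infimum by the single direction pointing from [x] to [z],
    where [|x + nu - z| = d - eps]; the second difference of [d^(-2N)] is at least
    [N^2 eps^2 d^(-2N-2)]. As a function of [|x - z|^2] the barrier is concave, so it lies
    below its tangent line, and since the hyperplane ball is symmetric its average exceeds
    [v x] by at most [k N eps^2 d^(-2N-2)]. For [N] larger than [2 / inf alpha] the barrier
    is a strict supersolution for every [eps <= sig/2], whence a comparison principle by
    looking at a maximum point of [u - v].

    With exterior balls at the scales [r / 5^j], comparison contracts the excess of [u]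
    over [M = sup F] by a factor independent of the scale, so finitely many steps make it
    smaller than [eta]. Comparison with [k -> 0] in a large ball gives the initial bound
    [u <= max F]. *)

(** * Euclidean norm and distance *)

Section euclid.
Context {R : realType} {n : nat}.
Implicit Types u v w x y z h : 'rV[R]_n.

Lemma edotC u v : edot u v = edot v u.
Proof. by apply: eq_bigr => i _; rewrite mulrC. Qed.

Lemma edotE u v : edot u v = (u *m v^T) 0 0.
Proof. by rewrite mxE; apply: eq_bigr => k _; rewrite mxE. Qed.

Lemma edotDl u v w : edot (u + v) w = edot u w + edot v w.
Proof. by rewrite -big_split; apply: eq_bigr => i _; rewrite mxE mulrDl. Qed.

Lemma edotZl (a : R) u v : edot (a *: u) v = a * edot u v.
Proof. by rewrite /edot mulr_sumr; apply: eq_bigr => i _; rewrite mxE mulrA. Qed.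

Lemma edotDr u v w : edot u (v + w) = edot u v + edot u w.
Proof. by rewrite !(edotC u) edotDl. Qed.

Lemma edotZr (a : R) u v : edot u (a *: v) = a * edot u v.
Proof. by rewrite !(edotC u) edotZl. Qed.

Lemma edot_ge0 u : 0 <= edot u u.
Proof. by apply: sumr_ge0 => i _; rewrite -expr2 sqr_ge0. Qed.

Lemma enorm_ge0 u : 0 <= enorm u. Proof. exact: sqrtr_ge0. Qed.

Lemma sqr_enorm u : enorm u ^+ 2 = edot u u.
Proof. by rewrite sqr_sqrtr // edot_ge0. Qed.

Lemma enormZ (a : R) u : enorm (a *: u) = `|a| * enorm u.
Proof. by rewrite /enorm edotZl edotZr mulrA sqrtrM ?sqr_ge0 // -expr2 sqrtr_sqr. Qed.

Lemma enormN u : enorm (- u) = enorm u.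
Proof. by rewrite -scaleN1r enormZ normrN1 mul1r. Qed.

Lemma enormB u v : enorm (u - v) = enorm (v - u).
Proof. by rewrite -opprB enormN. Qed.

Lemma le_coord_enorm u i : `|u 0 i| <= enorm u.
Proof.
rewrite -(ler_pXn2r (n:=2)) ?nnegrE ?enorm_ge0 // real_normK ?num_real //.
rewrite sqr_enorm /edot (bigD1 i) //= -expr2 lerDl.
by apply: sumr_ge0 => j _; rewrite -expr2 sqr_ge0.
Qed.

Lemma enorm0_eq0 u : enorm u = 0 -> u = 0.
Proof.
move=> u0; apply/rowP => i; rewrite mxE; apply/eqP.
by rewrite -normr_le0 -u0; exact: le_coord_enorm.
Qed.

Lemma enorm0 : enorm (0 : 'rV[R]_n) = 0.
Proof. by rewrite -(scale0r 0) enormZ normr0 mul0r. Qed.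

Lemma enorm_gt0 u : u != 0 -> 0 < enorm u.
Proof.
by move=> u0; rewrite lt_def enorm_ge0 andbT; apply: contra_neq u0; exact: enorm0_eq0.
Qed.

(** Expanding the squared norm of |v| u - |u| v gives 2 |u| |v| (|u| |v| - <u, v>), so the last
    factor is nonnegative once both vectors are nonzero. *)
Lemma cauchy_schwarz u v : edot u v <= enorm u * enorm v.
Proof.
have [->|u0] := eqVneq u 0.
  by rewrite -(scale0r 0) edotZl enormZ normr0 !mul0r.
have [->|v0] := eqVneq v 0.
  by rewrite -(scale0r 0) edotZr enormZ normr0 !mul0r mulr0.
have a0 := enorm_gt0 _ u0; have b0 := enorm_gt0 _ v0.
have := edot_ge0 (enorm v *: u + (- enorm u) *: v).
rewrite !(edotDl, edotDr, edotZl, edotZr) -!sqr_enorm (edotC v u).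
move: (edot u v) (enorm u) (enorm v) a0 b0 => d a b a0 b0 h.
have : 0 <= 2 * (a * b) * (a * b - d) by move: h; congr (_ <= _); ring.
by rewrite pmulr_rge0 ?subr_ge0 // !mulr_gt0.
Qed.

Lemma ler_enormD u v : enorm (u + v) <= enorm u + enorm v.
Proof.
rewrite -(ler_pXn2r (n:=2)) ?nnegrE ?addr_ge0 ?enorm_ge0 //.
rewrite sqr_enorm !(edotDl, edotDr) (edotC v u) sqrrD -!sqr_enorm.
by have := cauchy_schwarz u v; lra.
Qed.

Lemma ler_enormBD x y z : enorm (x - z) <= enorm (x - y) + enorm (y - z).
Proof. by rewrite -[x - z](subrKA y) ler_enormD. Qed.

Lemma le_norm_enorm u : `|u| <= enorm u.
Proof.
rewrite [leLHS]/Num.norm /= mx_normrE; apply: bigmax_le; first exact: enorm_ge0.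
by move=> [i j] _ /=; rewrite ord1 le_coord_enorm.
Qed.

(** A crude constant, positive for every [n]. Together with [le_norm_enorm] it identifies the
    Euclidean topology and bounded sets with those of the sup norm. *)
Lemma le_enorm_norm u : enorm u <= n.+1%:R * `|u|.
Proof.
rewrite -(ler_pXn2r (n:=2)) ?nnegrE ?enorm_ge0 ?mulr_ge0 //.
apply: (@le_trans _ _ (\sum_(i < n) `|u| ^+ 2)).
  rewrite sqr_enorm; apply: ler_sum => i _; rewrite -expr2.
  rewrite -real_normK ?num_real // ler_pXn2r ?nnegrE //.
  by rewrite [leRHS]/Num.norm /= mx_normrE; apply/bigmax_geP; right => /=; exists (0, i).
rewrite sumr_const card_ord -[leLHS]mulr_natl exprMn ler_wpM2r ?sqr_ge0 //.
by rewrite -natrX ler_nat expnS expn1 mulSn (leq_trans (leqnSn n)) ?leq_addr.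
Qed.

Lemma nbhs_eball x (e : R) : 0 < e -> nbhs x (eball x e).
Proof.
move=> e0; apply/nbhs_ballP; exists (e / n.+1%:R) => [|y]; first exact: divr_gt0.
rewrite -ball_normE /ball_ /eball /= => xy; rewrite enormB.
by apply: le_lt_trans (le_enorm_norm _) _; rewrite mulrC -ltr_pdivlMr.
Qed.

Lemma enorm_continuous z : continuous (fun x => enorm (x - z)).
Proof.
move=> x; apply/(@cvgrPdist_lt _ _ _ (nbhs x) (nbhs_filter x)) => e e0.
apply: (@filterS _ _ (nbhs_filter x) _ _ _ (nbhs_eball x e e0)) => y /= xy.
rewrite /eball /= in xy.
have h1 := ler_enormBD x y z; have h2 := ler_enormBD y x z.
by rewrite (enormB x y) in h1; rewrite ltr_norml; apply/andP; split; lra.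
Qed.

Lemma nbhs_sub_eball x (A : set 'rV[R]_n) :
  nbhs x A -> exists2 e : R, 0 < e & eball x e `<=` A.
Proof.
move=> /nbhs_ballP [e e0 eA]; exists e => // y xy; apply: eA.
rewrite -ball_normE /ball_ /=; apply: le_lt_trans (le_norm_enorm _) _.
by rewrite enormB.
Qed.

Lemma closure_eballP (A : set 'rV[R]_n) x :
  closure A x <-> forall e : R, 0 < e -> exists2 y, A y & enorm (y - x) < e.
Proof.
split=> [Ax e e0|h B /nbhs_sub_eball[e e0 eB]].
  by have [y [Ay xy]] := Ax _ (nbhs_eball x e e0); exists y.
by have [y Ay xy] := h e e0; exists y; split => //; exact: eB.
Qed.

Lemma bounded_set_enorm (A : set 'rV[R]_n) (M : R) :
  (forall x, A x -> enorm x <= M) -> bounded_set A.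
Proof.
move=> AM; exists M; split; first exact: num_real.
move=> N MN x Ax /=; apply: le_trans (le_norm_enorm x) _.
exact: le_trans (AM x Ax) (ltW MN).
Qed.

Lemma enorm_bounded_set (A : set 'rV[R]_n) :
  bounded_set A -> exists M : R, forall x, A x -> enorm x <= M.
Proof.
move=> [M [Mr hM]]; exists (n.+1%:R * (M + 1)) => x Ax.
apply: le_trans (le_enorm_norm x) _; rewrite ler_pM2l //.
by apply: (hM (M + 1)) => //; rewrite ltrDl.
Qed.

Lemma bounded_closure (A : set 'rV[R]_n) (M : R) :
  (forall x, A x -> enorm x <= M) -> forall x, closure A x -> enorm x <= M.
Proof.
move=> AM x /closure_eballP h; apply/ler_addgt0Pr => e e0.
have [y Ay xy] := h e e0; rewrite -(subrK y x).
apply: le_trans (ler_enormD _ _) _; rewrite addrC enormB.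
by rewrite lerD ?AM // ltW.
Qed.

Lemma dist_lbound x (A : set 'rV[R]_n) : lbound [set enorm (x - y) | y in A] 0.
Proof. by move=> _ [y _ <-]; exact: enorm_ge0. Qed.

Lemma dist_ge0 x (A : set 'rV[R]_n) : 0 <= dist x A.
Proof.
have [->|/set0P[a Aa]] := eqVneq A set0; first by rewrite /dist image_set0 inf0.
by apply: lb_le_inf; [exists (enorm (x - a)), a|exact: dist_lbound].
Qed.

Lemma dist_le x b (A : set 'rV[R]_n) : A b -> dist x A <= enorm (x - b).
Proof.
by move=> Ab; apply: ge_inf; [exists 0; exact: dist_lbound|exists b].
Qed.

(** Nonemptiness matters: [dist] to the empty set takes the default value 0. *)
Lemma dist_lt x (A : set 'rV[R]_n) (e : R) : A !=set0 -> dist x A < e ->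
  exists2 b, A b & enorm (x - b) < e.
Proof.
move=> [a Aa] h; have [|_ [b Ab <-] hb] := inf_lt _ h; last by exists b.
by exists (enorm (x - a)), a.
Qed.

End euclid.

(** * The enlarged domain and its boundary strips *)

Section geometry.
Context {R : realType} {n : nat}.
Variables (Omega : set 'rV[R]_n).
Hypothesis oO : open Omega.
Implicit Types (x y z h : 'rV[R]_n) (eps : R).

Lemma bdry_open x : bdry Omega x <-> closure Omega x /\ ~ Omega x.
Proof. by rewrite /bdry ((interior_id _).1 oO). Qed.

(** Otherwise [Omega] and its closure have the same trace on the segment, so the parameters landing
    in [Omega] form a nonempty clopen subset of [0, 1], hence all of it. The inequality is strict
    because the parameter found is positive. *)
Lemma segment_meets_bdry x h : Omega x -> ~ closure Omega (x + h) ->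
  exists2 b, bdry Omega b & enorm (x + h - b) < enorm h.
Proof.
move=> Ox nOxh.
have h0 : 0 < enorm h.
  by apply: enorm_gt0; apply/eqP => h0; apply: nOxh; rewrite h0 addr0; exact: subset_closure.
pose phi (t : R) : 'rV[R]_n := x + t *: h.
have cphi : continuous phi.
  move=> t; apply: cvgD; first exact: cvg_cst.
  by apply: cvgZr_tmp; exact: cvg_id.
suff [t /andP[t0 t1] bt] : exists2 t, 0 < t <= 1 & bdry Omega (phi t).
  exists (phi t) => //; rewrite /phi.
  have -> : x + h - (x + t *: h) = (1 - t) *: h.
    by rewrite scalerBl scale1r opprD addrACA subrr add0r.
  by rewrite enormZ ger0_norm ?subr_ge0 // gtr_pMl // ltrBlDr ltrDl.
apply: contrapT => nb.
have {}nb t : 0 <= t <= 1 -> closure Omega (phi t) -> Omega (phi t).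
  move=> /andP[]; rewrite le_eqVlt => /orP[/eqP <- _ _|t0 t1 ct].
    by rewrite /phi scale0r addr0.
  by apply: contrapT => nO; apply: nb; exists t; rewrite ?t0 //; apply/bdry_open.
have eqs : `[0, 1]%classic `&` phi @^-1` Omega = `[0, 1]%classic `&` phi @^-1` closure Omega.
  apply/seteqP; split => t /= [t01 Ot]; split => //; first exact: subset_closure.
  by apply: nb => //; move: t01; rewrite in_itv.
have /seteqP[_ h1] : `[0, 1]%classic `&` phi @^-1` Omega = `[0, 1]%classic.
  apply: (@segment_connected R 0 1).
  - by exists 0; split; rewrite /= ?in_itv /= ?lexx ?ler01 // /phi scale0r addr0.
  - by exists (phi @^-1` Omega) => //; apply: open_comp => // t _; exact: cphi.
  - exists (phi @^-1` closure Omega) => //; apply: closed_comp; last exact: closed_closure.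
    by move=> t _; exact: cphi.
have [|_ /=] := h1 1; first by rewrite /= in_itv /= lexx ler01.
by rewrite /phi scale1r => Oxh; apply: nOxh; exact: subset_closure.
Qed.

(** Steps of length exactly [eps] are allowed although [outer_strip] asks for a strict inequality:
    the boundary point crossed is strictly closer to [x + h] than [x] is. *)
Lemma enlarged_step eps x h : Omega x -> enorm h <= eps ->
  closure (enlarged Omega eps) (x + h).
Proof.
move=> Ox he; apply: subset_closure.
have [c|nc] := pselect (closure Omega (x + h)); [by left|right; split => //].
have [b bb xb] := segment_meets_bdry x h Ox nc.
by apply: le_lt_trans (dist_le _ _ _ bb) _; exact: lt_le_trans xb he.
Qed.

Lemma bdry_sub_Gamma eps x : 0 < eps -> bdry Omega x -> Gamma Omega eps x.
Proof.
move=> e0 bx; left; apply/closure_eballP => d d0.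
have /bdry_open[/closure_eballP cx _] := bx.
have [w Ow xw] := cx (Num.min d eps) ltac:(by rewrite lt_min d0).
exists w; last by apply: lt_le_trans xw _; rewrite ge_min lexx.
split => //; apply: le_lt_trans (dist_le _ _ _ bx) _.
by apply: lt_le_trans xw _; rewrite ge_min lexx orbT.
Qed.

Lemma enlarged_out_Gamma eps x : 0 < eps ->
  closure (enlarged Omega eps) x -> ~ Omega x -> Gamma Omega eps x.
Proof.
move=> e0; rewrite /enlarged closureU -((closure_id _).1 (@closed_closure _ Omega)) => -[cx nx|ox _]; last by right.
by apply: bdry_sub_Gamma => //; apply/bdry_open.
Qed.

Lemma Gamma_le (e1 e2 : R) : e1 <= e2 -> Gamma Omega e1 `<=` Gamma Omega e2.
Proof.
move=> e12 x [] h; [left|right]; move: h; apply: closureS => w [hw dw];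
  by split => //; exact: lt_le_trans dw e12.
Qed.

(** Outside the closure the operator is [F] by definition; on the boundary [delta] is 1, which
    cancels the sup-inf term. *)
Lemma dpp_out (p F : 'rV[R]_n -> R) eps u x : 0 < eps ->
  is_dpp_solution Omega p F eps u -> closure (enlarged Omega eps) x ->
  ~ Omega x -> u x = F x.
Proof.
move=> e0 [_ hu] cx nx; rewrite hu // /dpp_operator; case: ifP => // _.
rewrite /delta memNset; last by move=> [].
by rewrite memNset ?subrr ?mul0r ?add0r ?mul1r // => -[].
Qed.

Hypothesis bO : bounded_set Omega.
Hypothesis b0 : bdry Omega !=set0.

(** The bound is uniform in [eps <= 1] because a point of an outer strip is then within distance 1
    of the boundary. *)
Lemma enlarged_bounded : exists M : R, forall eps x, eps <= 1 ->
  closure (enlarged Omega eps) x \/ Gamma Omega eps x -> enorm x <= M.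
Proof.
have [M hM] := enorm_bounded_set _ bO.
have hMc := bounded_closure _ _ hM.
have hO eps x : eps <= 1 -> outer_strip Omega eps x -> enorm x <= M + 1.
  move=> e1 [_ dx]; have [b /bdry_open[cb _] xb] := dist_lt _ _ _ b0 dx.
  rewrite -(subrK b x); apply: le_trans (ler_enormD _ _) _; rewrite addrC.
  by rewrite lerD ?hMc // ltW // (lt_le_trans xb).
exists (M + 1) => eps x e1 [|[]]; apply: bounded_closure => {}x.
- by move=> [/hMc|/hO] h; [apply: le_trans h _; rewrite lerDl|exact: h].
- by move=> [/hM h _]; apply: le_trans h _; rewrite lerDl.
- exact: hO.
Qed.

Lemma enlarged_compact eps : eps <= 1 -> compact (closure (enlarged Omega eps)).
Proof.
move=> e1; apply: bounded_closed_compact; last exact: closed_closure.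
have [M hM] := enlarged_bounded.
by apply: (@bounded_set_enorm _ _ _ M) => x cx; apply: hM e1 _; left.
Qed.

Lemma Gamma_compact eps : eps <= 1 -> compact (Gamma Omega eps).
Proof.
move=> e1; apply: bounded_closed_compact; last by apply: closedU; exact: closed_closure.
have [M hM] := enlarged_bounded.
by apply: (@bounded_set_enorm _ _ _ M) => x cx; apply: hM e1 _; right.
Qed.

End geometry.

Lemma compact_continuous_bounded (R : realType) (T : topologicalType) (A : set T)
    (f : T -> R) : compact A -> {within A, continuous f} ->
  exists M : R, forall x, A x -> `|f x| <= M.
Proof.
move=> cA cf; have /compact_bounded[M [Mr hM]] := continuous_compact cf cA.
exists (M + 1) => x Ax; apply: (hM (M + 1)); first by rewrite ltrDl.
by exists x.
Qed.

(** * Lebesgue measure on tuples *)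

Section measure.
Context {R : realType}.
Local Notation mR := (measurableTypeR R).

(* [f] and [g] need not be measurable: the integral is a difference of suprema over
   simple functions. This avoids proving that [u] is measurable on hyperplanes. *)
Lemma le_integral_pointwise (d : measure_display) (T : measurableType d)
    (mu : {measure set T -> \bar R}) (D : set T) (f g : T -> \bar R) :
  (forall t, D t -> (f t <= g t)%E) ->
  (\int[mu]_(t in D) f t <= \int[mu]_(t in D) g t)%E.
Proof.
move=> fg.
have rfg t : ((f \_ D) t <= (g \_ D) t)%E.
  by rewrite !patchE; case: ifPn => // /set_mem; exact: fg.
rewrite /integral; apply: leeB; apply: ereal_sup_le => _ [h hh <-] /=;
  exists h => // t; apply: (le_trans (hh t)).
  by apply: (@funepos_le _ _ setT) => //; rewrite inE.
by apply: (@funeneg_le _ _ setT) => //; rewrite inE.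
Qed.

Definition tuple_opp (m : nat) (t : m.-tuple mR) : m.-tuple mR :=
  [tuple - tnth t i | i < m].

Lemma measurable_tuple_opp (m : nat) : measurable_fun setT (@tuple_opp m).
Proof.
apply/measurable_fun_tnthP => i; rewrite (_ : _ \o _ = -%R \o (@tnth m mR)^~ i).
  by apply: measurableT_comp => //; exact: measurable_tnth.
by apply/funext => t /=; rewrite tnth_mktuple.
Qed.

(** Induction on the dimension: the section at [x] of the reflected set is the reflection of the
    section at [- x], and Lebesgue measure on the line is invariant under negation. *)
Lemma lebesgue_tupleN (m : nat) (A : set (m.-tuple mR)) : measurable A ->
  lebesgue_tuple m (@tuple_opp m @^-1` A) = lebesgue_tuple m A.
Proof.
elim: m A => [A _|m IH A mA].
  rewrite (_ : _ @^-1` A = A) //.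
  by apply/seteqP; split => t /=; rewrite (tuple0 (tuple_opp _ _)) (tuple0 t).
have mB : measurable (@tcons R m @^-1` A).
  by rewrite -[X in measurable X]setTI; exact: measurable_tcons.
rewrite /= /lebesgue_step /pushforward /product_measure1.
under eq_integral => x _.
  rewrite /= (_ : xsection _ _ =
      @tuple_opp m @^-1` (xsection (@tcons R m @^-1` A) (- x))); last first.
    apply/seteqP; split => t /=; rewrite /xsection /= !inE /=;
      congr (A _); apply: eq_from_tnth => i; rewrite tnth_mktuple;
      by case: (unliftP ord0 i) => [j|] ->; rewrite ?tnth0 // !tnthS tnth_mktuple.
  rewrite IH; last exact: measurable_xsection.
  over.
have mN : measurable_fun setT (-%R : mR -> mR) by exact: oppr_measurable.
rewrite -(ge0_integral_pushforward mN (@lebesgue_measure R) (D := setT) (f :=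
   (lebesgue_tuple m \o xsection (@tcons R m @^-1` A)))) //=.
- by apply: eq_measure_integral => //= B mB' _; exact: lebesgue_measureN.
- exact: measurable_fun_xsection.
Qed.

(** Cubes have an explicit measure; one around a ball and one inside it show that the measure of the
    ball is finite and positive. *)
Definition tuple_box (m : nat) (a : R) : set (m.-tuple mR) :=
  [set t | forall i, `|tnth t i| < a].

Lemma measurable_tuple_box m a : measurable (@tuple_box m a).
Proof.
rewrite (_ : tuple_box m a =
    \bigcap_(i in [set: 'I_m]) ((@tnth m mR)^~ i @^-1` [set` `]- a, a[ ])).
  apply: fin_bigcap_measurable => // i _.
  by rewrite -[X in measurable X]setTI; exact: measurable_tnth.
apply/seteqP; split => t /=.
  by move=> h i _ /=; rewrite in_itv /= -ltr_norml.
by move=> h i; have := h i I; rewrite /= in_itv /= -ltr_norml.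
Qed.

Lemma lebesgue_tuple_box (m : nat) (a : R) : 0 < a ->
  lebesgue_tuple m (tuple_box m a) = ((2 * a) ^+ m)%:E.
Proof.
move=> a0; elim: m => [|m IH].
  by rewrite /= diracE mem_set //= => -[].
rewrite /= /lebesgue_step /pushforward.
rewrite (_ : _ @^-1` _ = `]- a, a[%classic `*` tuple_box m a).
  rewrite product_measure1E //; last exact: measurable_tuple_box.
  rewrite [X in (_ * X)%E]IH.
  have hI : lebesgue_measure (`]- a, a[%classic : set R) = (2 * a)%:E.
    by rewrite lebesgue_measure_itv /= lte_fin gtrN // -EFinD; congr (_%:E); ring.
  transitivity ((2 * a)%:E * ((2 * a) ^+ m)%:E)%E; first by congr (_ * _)%E; exact: hI.
  by rewrite -EFinM exprS.
apply/seteqP; split => -[x t] /=; rewrite in_itv /= -ltr_norml.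
  by move=> h; split => [|i]; [exact: (h ord0)|have := h (lift ord0 i); rewrite tnthS].
by move=> [hx ht] i; case: (unliftP ord0 i) => [j|] ->; rewrite ?tnth0 ?tnthS.
Qed.

Definition tuple_ball (m : nat) (a : R) : set (m.-tuple mR) :=
  [set t | \sum_(i < m) tnth t i ^+ 2 < a ^+ 2].

Lemma measurable_tuple_ball m a : measurable (@tuple_ball m a).
Proof.
rewrite (_ : tuple_ball m a = (fun t : m.-tuple mR => \sum_(i < m) tnth t i ^+ 2) @^-1`
   [set` `]-oo, a ^+ 2[ ]).
  rewrite -[X in measurable X]setTI; apply: measurable_sum => // i.
  by apply: (@measurableT_comp _ _ _ _ mR _ (fun x : mR => x ^+ 2)) => //; exact: measurable_tnth.
by apply/seteqP; split => t /=; rewrite in_itv.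
Qed.

Lemma tuple_ball_sub_box m a : 0 < a -> tuple_ball m a `<=` tuple_box m a.
Proof.
move=> a0 t /= h i; rewrite -(ltr_pXn2r (n:=2)) ?nnegrE ?(ltW a0) //.
rewrite real_normK ?num_real //; apply: le_lt_trans h.
by rewrite (bigD1 i) //= lerDl; apply: sumr_ge0 => j _; exact: sqr_ge0.
Qed.

(** The half-side is small enough in every dimension, [m = 0] included: m (a / (m + 1))^2 < a^2. *)
Lemma tuple_box_sub_ball m a : 0 < a ->
  tuple_box m (a / m.+1%:R) `<=` tuple_ball m a.
Proof.
move=> a0 t /= h.
have b0 : 0 < a / m.+1%:R by rewrite divr_gt0.
apply: (@le_lt_trans _ _ (\sum_(i < m) (a / m.+1%:R) ^+ 2)).
  apply: ler_sum => i _; rewrite -[leLHS]real_normK ?num_real //.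
  by rewrite ler_pXn2r ?nnegrE ?(ltW b0) // ltW.
rewrite sumr_const card_ord -[ltLHS]mulr_natl expr_div_n mulrCA gtr_pMr ?exprn_gt0 //.
rewrite ltr_pdivrMr ?exprn_gt0 // mul1r -natrX ltr_nat.
by rewrite expnS expn1 mulSn leq_addr.
Qed.

Lemma lebesgue_tuple_ball_lty m a : 0 < a ->
  (lebesgue_tuple m (tuple_ball m a) < +oo)%E.
Proof.
move=> a0; apply: (@le_lt_trans _ _ (lebesgue_tuple m (tuple_box m a))).
  by apply: le_measure; rewrite ?inE; [exact: measurable_tuple_ball|
    exact: measurable_tuple_box|exact: tuple_ball_sub_box].
by rewrite lebesgue_tuple_box // ltry.
Qed.

Lemma lebesgue_tuple_ball_gt0 m a : 0 < a ->
  (0 < lebesgue_tuple m (tuple_ball m a))%E.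
Proof.
move=> a0; have b0 : 0 < a / m.+1%:R by rewrite divr_gt0.
apply: (@lt_le_trans _ _ (lebesgue_tuple m (tuple_box m (a / m.+1%:R)))).
  by rewrite lebesgue_tuple_box // lte_fin exprn_gt0 // mulr_gt0.
by apply: le_measure; rewrite ?inE; [exact: measurable_tuple_box|
    exact: measurable_tuple_ball|exact: tuple_box_sub_ball].
Qed.

(** The ball is invariant under reflection, so a change of variables shows that the integral equals
    its own opposite; integrability makes it finite, hence zero. *)
Lemma Rintegral_tuple_ball_odd m a (g : m.-tuple mR -> R) : 0 < a ->
  measurable_fun setT g -> (forall t, g (tuple_opp m t) = - g t) ->
  (lebesgue_tuple m).-integrable (tuple_ball m a) (EFin \o g) ->
  \int[lebesgue_tuple m]_(t in tuple_ball m a) g t = 0.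
Proof.
move=> a0 mg gN ig.
have DN : tuple_opp m @^-1` tuple_ball m a = tuple_ball m a.
  apply/seteqP; split => t; rewrite /preimage /tuple_ball /= => h;
    apply: le_lt_trans h; apply: ler_sum => i _; by rewrite tnth_mktuple sqrrN.
have : (\int[lebesgue_tuple m]_(t in tuple_ball m a) (g t)%:E
    = - \int[lebesgue_tuple m]_(t in tuple_ball m a) (g t)%:E)%E.
  transitivity (\int[pushforward (lebesgue_tuple m) (tuple_opp m)]_(t in tuple_ball m a) (g t)%:E)%E.
    have mT := @measurable_tuple_opp m.
    by apply: eq_measure_integral => //= A mA _; exact/esym/lebesgue_tupleN.
  rewrite integral_pushforward //.
  - rewrite DN -integralN /=.
      by apply: eq_integral => t _ /=; rewrite gN.
    exact: (integrable_add_def (measurable_tuple_ball m a) ig).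
  - exact: measurable_tuple_opp.
  - exact/measurable_EFinP.
  - rewrite DN; have mB := measurable_tuple_ball m a.
    apply: (@eq_integrable _ _ _ _ _ mB (fun t => - (EFin \o g) t)%E).
      by move=> t _ /=; rewrite gN.
    exact: integrableN.
  - exact: measurable_tuple_ball.
rewrite /Rintegral.
have := integrable_fin_num (measurable_tuple_ball m a) ig.
by case: (\int[_]_(t in _) _)%E => //= x _ [] ?; lra.
Qed.

End measure.

(** * Averages over hyperplane balls *)

(** Here [f] may fail to be measurable. The finite integrals of [a] and [b] force the extended
    integral of [f] to be finite, so [fine] preserves the order. *)
Lemma Rintegral_sandwich [d : measure_display] [T : measurableType d]
    [R : realType] [mu : {measure set T -> \bar R}] [D : set T] [a f b : T -> R] :
  measurable D -> mu.-integrable D (EFin \o a) -> mu.-integrable D (EFin \o b) ->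
  (forall t, D t -> a t <= f t <= b t) ->
  \int[mu]_(t in D) a t <= \int[mu]_(t in D) f t <= \int[mu]_(t in D) b t.
Proof.
move=> mD ia ib afb.
have af : (\int[mu]_(t in D) (a t)%:E <= \int[mu]_(t in D) (f t)%:E)%E.
  by apply: le_integral_pointwise => t /afb /andP[? _]; rewrite lee_fin.
have fb : (\int[mu]_(t in D) (f t)%:E <= \int[mu]_(t in D) (b t)%:E)%E.
  by apply: le_integral_pointwise => t /afb /andP[_ ?]; rewrite lee_fin.
have fa := integrable_fin_num mD ia; have hb := integrable_fin_num mD ib.
rewrite /Rintegral; move: fa hb af fb.
case: (\int[mu]_(t in D) (a t)%:E)%E => //= x _.
case: (\int[mu]_(t in D) (b t)%:E)%E => //= z _.
by case: (\int[mu]_(t in D) (f t)%:E)%E => //= v; rewrite !lee_fin => -> ->.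
Qed.

Section average.
Context {R : realType} {n : nat}.
Variables (nu : 'rV[R]_n).
Hypothesis nu0 : nu != 0.
Local Notation mR := (measurableTypeR R).
Implicit Types (t : n.-1.-tuple mR).

Lemma enorm_hyperplane_pt t :
  enorm (hyperplane_pt nu t) ^+ 2 = \sum_(i < n.-1) tnth t i ^+ 2.
Proof.
have [AA _] := frameP nu0.
rewrite sqr_enorm edotE /hyperplane_pt trmx_mul mulmxA -(mulmxA _ (frame nu)) AA mulmx1.
by rewrite mxE; apply: eq_bigr => k _; rewrite !mxE expr2.
Qed.

Lemma edot_hyperplane_pt t : edot (hyperplane_pt nu t) nu = 0.
Proof.
have [_ An] := frameP nu0.
by rewrite edotE /hyperplane_pt -mulmxA An mulmx0 mxE.
Qed.

Lemma hyperplane_ptN t : hyperplane_pt nu (tuple_opp _ t) = - hyperplane_pt nu t.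
Proof.
rewrite /hyperplane_pt -mulNmx.
rewrite (_ : \row_i _ = - \row_i tnth t i) //.
by apply/rowP => i; rewrite !mxE tnth_mktuple.
Qed.

Lemma preimage_hball eps : 0 < eps ->
  hyperplane_pt nu @^-1` hball eps nu = tuple_ball n.-1 eps.
Proof.
move=> e0.
have eq t : (enorm (hyperplane_pt nu t) < eps) = (\sum_(i < n.-1) tnth t i ^+ 2 < eps ^+ 2).
  by rewrite -enorm_hyperplane_pt ltr_pXn2r ?nnegrE ?enorm_ge0 // ltW.
apply/seteqP; split => t; rewrite /preimage /hball /tuple_ball /=.
  by move=> []; rewrite eq.
by rewrite -eq edot_hyperplane_pt.
Qed.

(** This is the averaged factor of [W] in the same form, so that its bounds apply to [W]
    directly. *)
Definition haverage eps (f : 'rV[R]_n -> R) : R :=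
  (fine (hyperplane_measure nu (hball eps nu)))^-1
  * hyperplane_integral nu (hball eps nu) f.

(* The linear part [edot w] of the upper bound averages to zero. *)
Lemma haverage_bounds eps (f : 'rV[R]_n -> R) (C c : R) (w : 'rV[R]_n) :
  0 < eps ->
  (forall h, hball eps nu h -> - C <= f h <= c + edot w h) ->
  - C <= haverage eps f <= c.
Proof.
move=> e0 hf.
pose D := tuple_ball n.-1 eps; pose mu := @lebesgue_tuple R n.-1.
have mD : measurable D by exact: measurable_tuple_ball.
have Dy : (mu D < +oo)%E by exact: lebesgue_tuple_ball_lty.
have V0 : 0 < fine (mu D).
  by rewrite fine_gt0 // Dy andbT; exact: lebesgue_tuple_ball_gt0.
pose g t := edot w (hyperplane_pt nu t).
(* Measurability comes from writing [g] as a linear form in the coordinates of [t]. *)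
have mg : measurable_fun setT g.
  rewrite (_ : g = fun t : n.-1.-tuple mR => \sum_(j < n) \sum_(i < n.-1)
      tnth t i * (w 0 j * frame nu i j)).
    apply: measurable_sum => j; apply: measurable_sum => i.
    apply: (@measurableT_comp _ _ _ _ mR _ ( *%R^~ (w 0 j * frame nu i j))).
      exact: mulrr_measurable.
    exact: measurable_tnth.
  apply/funext => t; apply: eq_bigr => j _; rewrite /hyperplane_pt mxE mulr_sumr.
  by apply: eq_bigr => i _; rewrite mxE mulrCA.
have ig : mu.-integrable D (EFin \o g).
  apply: measurable_bounded_integrable => //; first exact: measurable_funTS.
  exists (enorm w * eps); split; first exact: num_real.
  move=> M hM t /= Dt; apply: le_trans (ltW hM).
  have Dn : enorm (hyperplane_pt nu t) <= eps.
    by move: Dt; rewrite /D -preimage_hball // => -[/ltW].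
  rewrite ler_norml; apply/andP; split.
    rewrite lerNl -mulN1r -edotZl.
    apply: le_trans (cauchy_schwarz _ _) _.
    by rewrite enormZ normrN1 mul1r ler_wpM2l // enorm_ge0.
  by apply: le_trans (cauchy_schwarz _ _) _; rewrite ler_wpM2l // enorm_ge0.
have ic k : mu.-integrable D (EFin \o cst k).
  apply: measurable_bounded_integrable => //.
  by exists `|k|; split => [|M /ltW hM t _ //]; exact: num_real.
have icg : mu.-integrable D (EFin \o (fun t => c + g t)).
  exact: (integrableD mD (ic c) ig).
have g0 : \int[mu]_(t in D) g t = 0.
  apply: Rintegral_tuple_ball_odd => // t.
  by rewrite /g hyperplane_ptN -scaleN1r edotZr mulN1r.
have hD t : D t -> - C <= f (hyperplane_pt nu t) <= c + g t.
  by move=> Dt; apply: hf; move: Dt; rewrite /D -preimage_hball.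
have /andP[] := Rintegral_sandwich mD (ic (- C)) icg hD.
rewrite RintegralD // ?g0 ?addr0; last exact: (ic c).
rewrite !Rintegral_cst // /haverage /hyperplane_measure /hyperplane_integral.
rewrite preimage_hball // -/D -/mu => h1 h2.
by rewrite ![_^-1 * _]mulrC ler_pdivlMr // h1 ler_pdivrMr.
Qed.

End average.

(** * Negative powers of the distance *)

Section power.
Context {R : realType}.
Implicit Types (x d e s t : R) (N : nat).

(** Induction: [x] times the bound for [N] exceeds the bound for [N + 1] by N (x - 1)^2. *)
Lemma bernoulli x N : 0 <= x -> 1 + N%:R * (x - 1) <= x ^+ N.
Proof.
move=> x0; elim: N => [|N IH]; first by rewrite mul0r addr0 expr0.
rewrite exprS; apply: le_trans (ler_wpM2l x0 IH).
rewrite -subr_ge0 -natr1.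
have -> : x * (1 + N%:R * (x - 1)) - (1 + (N%:R + 1) * (x - 1)) = N%:R * (x - 1) ^+ 2.
  by ring.
by rewrite mulr_ge0 ?sqr_ge0.
Qed.

Lemma le_invX N s t : 0 < s -> s <= t -> t^-1 ^+ N <= s^-1 ^+ N.
Proof.
move=> s0 st; have t0 := lt_le_trans s0 st.
by rewrite lerXn2r ?nnegrE ?invr_ge0 ?(ltW s0) ?(ltW t0) // lef_pV2.
Qed.

Lemma lt_invX N s t : (0 < N)%N -> 0 < s -> s < t -> t^-1 ^+ N < s^-1 ^+ N.
Proof.
move=> N0 s0 st; have t0 := lt_trans s0 st.
by rewrite ltrXn2r ?nnegrE ?invr_ge0 ?(ltW s0) ?(ltW t0) // ?ltf_pV2 // -lt0n.
Qed.

(** Convexity of s^(-N). After factoring out t^(-N), apply Bernoulli to t / s and note that t / s -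
    1 exceeds -(s - t) / t by (s - t)^2 / (s t). *)
Lemma invX_tangent N s t : 0 < s -> 0 < t ->
  t^-1 ^+ N - N%:R * (t^-1 ^+ N * t^-1) * (s - t) <= s^-1 ^+ N.
Proof.
move=> s0 t0; have sn : s != 0 by rewrite gt_eqF.
have tn : t != 0 by rewrite gt_eqF.
have -> : s^-1 = t^-1 * (t / s) by rewrite mulrA mulVf ?mul1r.
rewrite exprMn; have T0 : 0 < t^-1 ^+ N by rewrite exprn_gt0 ?invr_gt0.
apply: (@le_trans _ _ (t^-1 ^+ N * (1 + N%:R * (t / s - 1)))); last first.
  by rewrite ler_wpM2l ?(ltW T0) // bernoulli // divr_ge0 // ltW.
rewrite -subr_ge0.
have -> : t^-1 ^+ N * (1 + N%:R * (t / s - 1))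
   - (t^-1 ^+ N - N%:R * (t^-1 ^+ N * t^-1) * (s - t))
   = t^-1 ^+ N * N%:R * ((s - t) ^+ 2 / (s * t)) by field; rewrite sn tn.
apply: mulr_ge0; first by rewrite mulr_ge0 ?(ltW T0).
by rewrite divr_ge0 ?sqr_ge0 // mulr_ge0 // ltW.
Qed.

(* Write the right-hand side as [A^2 + B^2 = (B - A)^2 + 2 A B]; the first square gives the
   quadratic growth in [N], by Bernoulli. *)
Lemma invX_second_difference N d e : 0 <= e -> e < d ->
  (d ^+ 2)^-1 ^+ N * (2 + N%:R ^+ 2 * (e ^+ 2 * (d ^+ 2)^-1))
  <= ((d + e) ^+ 2)^-1 ^+ N + ((d - e) ^+ 2)^-1 ^+ N.
Proof.
move=> e0 ed; have d0 : 0 < d by exact: le_lt_trans ed.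
have de0 : 0 < d - e by rewrite subr_gt0.
have sq (c : R) : (c ^+ 2)^-1 ^+ N = (c^-1 ^+ N) ^+ 2 by rewrite -exprVn -!exprM mulnC.
rewrite !sq; set A := (d + e)^-1 ^+ N; set B := (d - e)^-1 ^+ N; set D := d^-1 ^+ N.
have D0 : 0 < D by rewrite exprn_gt0 ?invr_gt0.
have AD : A <= D by apply: le_invX; rewrite // lerDl.
have BD : D * (1 + N%:R * (e / d)) <= B.
  have -> : B = D * (d / (d - e)) ^+ N.
    by rewrite /B /D -exprMn mulrA mulVf ?mul1r // gt_eqF.
  rewrite ler_wpM2l ?(ltW D0) //; apply: le_trans (bernoulli _ N _); last first.
    by rewrite divr_ge0 // ltW.
  rewrite lerD2l ler_wpM2l // -subr_ge0.
  have -> : d / (d - e) - 1 - e / d = e ^+ 2 / ((d - e) * d).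
    by field; rewrite !gt_eqF.
  by rewrite divr_ge0 ?sqr_ge0 // mulr_ge0 ?ltW.
(* The product [A * B] is (d^2 - e^2)^(-N). *)
have ABD : D ^+ 2 <= A * B.
  rewrite /A /B /D -exprMn -exprM mulnC exprM -invfM exprVn; apply: le_invX.
    by rewrite mulr_gt0 // ltr_pwDl.
  by have := sqr_ge0 e; lra.
have x0 : 0 <= D * (N%:R * (e / d)).
  by rewrite mulr_ge0 ?(ltW D0) // mulr_ge0 // divr_ge0 // ltW.
have : (D * (N%:R * (e / d))) ^+ 2 <= (B - A) ^+ 2.
  by rewrite lerXn2r ?nnegrE //; lra.
have -> : D ^+ 2 * (2 + N%:R ^+ 2 * (e ^+ 2 * (d ^+ 2)^-1)) =
   2 * D ^+ 2 + (D * (N%:R * (e / d))) ^+ 2 by field; rewrite gt_eqF.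
by lra.
Qed.

(** The second difference grows like N^2 and the averaging loss like N; their comparison reduces to
    the sign of a N - 2 b. *)
Lemma invX_gain N d e (a b : R) : 0 < e -> e < d -> 0 < a -> 2 * b < a * N%:R ->
  (0 < N)%N ->
  2 * b * (N%:R * ((d ^+ 2)^-1 ^+ N * (d ^+ 2)^-1) * e ^+ 2)
  < a * (((d + e) ^+ 2)^-1 ^+ N + ((d - e) ^+ 2)^-1 ^+ N - 2 * (d ^+ 2)^-1 ^+ N).
Proof.
move=> e0 ed a0 ab N0; have d0 : 0 < d by exact: lt_trans ed.
have h := invX_second_difference N _ _ (ltW e0) ed.
have {h} : a * ((d ^+ 2)^-1 ^+ N * (N%:R ^+ 2 * (e ^+ 2 * (d ^+ 2)^-1))) <=
   a * (((d + e) ^+ 2)^-1 ^+ N + ((d - e) ^+ 2)^-1 ^+ N - 2 * (d ^+ 2)^-1 ^+ N).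
  by rewrite ler_wpM2l ?(ltW a0) //; lra.
apply: lt_le_trans; rewrite -subr_gt0.
set D := (d ^+ 2)^-1 ^+ N; set c := (d ^+ 2)^-1.
have -> : a * (D * (N%:R ^+ 2 * (e ^+ 2 * c))) - 2 * b * (N%:R * (D * c) * e ^+ 2) =
  (a * N%:R - 2 * b) * (N%:R * (D * c * e ^+ 2)) by ring.
by rewrite !mulr_gt0 ?exprn_gt0 ?invr_gt0 ?exprn_gt0 ?subr_gt0 // ltr0n.
Qed.

End power.

(** * The one-step estimate: strict supersolution property of the barrier *)

Section supersolution.
Context {R : realType} {n : nat}.
Variables (p : 'rV[R]_n -> R) (eps : R) (u : 'rV[R]_n -> R) (x z : 'rV[R]_n).
Variables (N : nat) (k V C : R).
Hypotheses (eps0 : 0 < eps) (epsd : eps < enorm (x - z)) (k0 : 0 < k) (N0 : (0 < N)%N).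
Hypotheses (alpha0 : 0 < alpha p x) (alpha1 : alpha p x <= 1)
  (alphaN : 2 * beta p x < alpha p x * N%:R).
Hypothesis uC : forall h, enorm h <= eps -> - C <= u (x + h).
Hypothesis uV : forall h, enorm h <= eps ->
  u (x + h) <= V - k * (enorm (x + h - z) ^+ 2)^-1 ^+ N.

Let d := enorm (x - z).
Let G := (d ^+ 2)^-1 ^+ N.
Let c := V - k * G + k * (N%:R * (G * (d ^+ 2)^-1) * eps ^+ 2).

Let d0 : 0 < d. Proof. exact: lt_trans epsd. Qed.

Let shift_gt0 h : enorm h <= eps -> 0 < enorm (x + h - z).
Proof.
move=> he; have := ler_enormBD x (x + h) z.
rewrite opprD addrA subrr sub0r enormN -/d => h1.
by have := epsd; rewrite -/d; lra.
Qed.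

(** The tangent line at d^2 bounds the barrier by an affine function of |x + h - z|^2 - d^2, which
    is at most 2 <x - z, h> + eps^2. The linear term averages out and eps^2 produces the remainder
    in [c]. *)
Let haverage_barrier nu : enorm nu = eps ->
  - C <= haverage nu eps (fun h => u (x + h)) <= c.
Proof.
move=> nue; apply: (@haverage_bounds _ _ _ _ _ _ _ _
  ((2 * (k * (N%:R * (G * (d ^+ 2)^-1)))) *: (x - z))) => //.
  by apply/eqP => nu0; move: eps0; rewrite -nue nu0 enorm0 ltxx.
move=> h [/ltW he _]; rewrite uC //=; apply: le_trans (uV _ he) _.
have hT := @invX_tangent R N (enorm (x + h - z) ^+ 2) (d ^+ 2)
   ltac:(by rewrite exprn_gt0 // shift_gt0) ltac:(by rewrite exprn_gt0).
rewrite edotZl /c.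
have dd : enorm (x + h - z) ^+ 2 - d ^+ 2 <= 2 * edot (x - z) h + eps ^+ 2.
  rewrite (_ : x + h - z = (x - z) + h); last by rewrite addrAC.
  rewrite sqr_enorm edotDl !(edotDr _ (x - z) h) -!sqr_enorm -/d (edotC h).
  have : enorm h ^+ 2 <= eps ^+ 2 by rewrite lerXn2r ?nnegrE ?enorm_ge0 ?(ltW eps0).
  by move: (edot (x - z) h) => q; lra.
have K0 : 0 <= N%:R * (G * (d ^+ 2)^-1).
  by rewrite !mulr_ge0 // ?exprn_ge0 // invr_ge0 ?exprn_ge0 // ltW.
move: (ler_wpM2l K0 dd) hT; rewrite -/G.
set K := N%:R * (G * _); set E := enorm (x + h - z) ^+ 2 - d ^+ 2.
move: (edot _ _) => q h1 h2.
have h3 : G - K * (2 * q + eps ^+ 2) <= (enorm (x + h - z) ^+ 2)^-1 ^+ N by lra.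
have := ler_wpM2l (ltW k0) h3.
by lra.
Qed.

Let beta0 : 0 <= beta p x. Proof. by rewrite subr_ge0. Qed.

(** Used with [e] equal to [d + eps] in all directions for the supremum, and to [d - eps] in a
    single direction for the infimum. *)
Let W_le nu (e : R) : enorm nu = eps -> enorm (x + nu - z) <= e ->
  W p eps u x nu <= alpha p x * (V - k * (e ^+ 2)^-1 ^+ N) + beta p x * c.
Proof.
move=> nue xe; rewrite /W; apply: lerD; last first.
  by rewrite ler_wpM2l //; have /andP[] := haverage_barrier _ nue.
rewrite ler_wpM2l ?(ltW alpha0) //; apply: le_trans (uV _ _) _; first by rewrite nue.
have s0 := @shift_gt0 nu ltac:(by rewrite nue).
rewrite lerD2l lerN2 ler_wpM2l ?(ltW k0) //; apply: le_invX; first by rewrite exprn_gt0.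
by rewrite lerXn2r ?nnegrE ?enorm_ge0 // (le_trans _ xe) ?enorm_ge0.
Qed.

(** Both bounds contain the same averaging term [c], so their sum reduces to [k] times the
    inequality of [invX_gain]. *)
Lemma W_sup_inf_lt :
  sup [set W p eps u x nu | nu in [set nu | enorm nu = eps]]
  + inf [set W p eps u x nu | nu in [set nu | enorm nu = eps]] < 2 * (V - k * G).
Proof.
pose nu0 := - (eps / d) *: (x - z).
have nu0e : enorm nu0 = eps.
  by rewrite enormZ normrN ger0_norm ?divr_ge0 ?ltW // -/d divfK // gt_eqF.
have xnu0 : enorm (x + nu0 - z) <= d - eps.
  have -> : x + nu0 - z = (1 - eps / d) *: (x - z).
    by rewrite scalerBl scale1r /nu0 scaleNr addrAC.
  rewrite enormZ -/d ger0_norm; last by rewrite subr_ge0 ler_pdivrMr // mul1r ltW.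
  by rewrite mulrBl mul1r divfK // gt_eqF.
have hs : sup [set W p eps u x nu | nu in [set nu | enorm nu = eps]]
   <= alpha p x * (V - k * ((d + eps) ^+ 2)^-1 ^+ N) + beta p x * c.
  apply: ge_sup; first by exists (W p eps u x nu0), nu0.
  move=> _ [nu /= nue <-]; apply: W_le => //.
  by rewrite addrAC (le_trans (ler_enormD _ _)) // nue.
have hi : inf [set W p eps u x nu | nu in [set nu | enorm nu = eps]]
   <= alpha p x * (V - k * ((d - eps) ^+ 2)^-1 ^+ N) + beta p x * c.
  apply: le_trans (W_le _ _ nu0e xnu0); apply: ge_inf; last by exists nu0.
  (* The [inf] is a true infimum only for a set bounded below; [- C] is a lower bound because the
     weights [alpha] and [beta] sum to 1. *)
  exists (- C) => _ [nu /= nue <-]; rewrite /W.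
  have -> : - C = alpha p x * - C + beta p x * - C by rewrite /beta; ring.
  apply: lerD; first by rewrite ler_wpM2l ?(ltW alpha0) // uC // nue.
  by rewrite ler_wpM2l //; have /andP[] := haverage_barrier _ nue.
apply: le_lt_trans (lerD hs hi) _.
have hg := invX_gain _ _ _ _ _ eps0 epsd alpha0 alphaN N0; rewrite -/d -/G in hg.
rewrite -(ltr_pM2l k0) in hg.
by move: hg; rewrite /c /beta; lra.
Qed.

End supersolution.

(** * Comparison with the barrier *)

Section comparison.
Context {R : realType} {n : nat}.
Variables (Omega : set 'rV[R]_n) (p F : 'rV[R]_n -> R) (N : nat).
Hypotheses (oO : open Omega) (bO : bounded_set Omega) (b0 : bdry Omega !=set0).
Hypothesis N0 : (0 < N)%N.
Hypothesis hp : forall x, Omega x ->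
  [/\ 0 < alpha p x, alpha p x <= 1 & 2 * beta p x < alpha p x * N%:R].
Implicit Types (x z : 'rV[R]_n) (sig P M k eps : R).

(** The value [M] is taken at [sig / 2] rather than at [sig]: points reached by a step of length at
    most [sig / 2] from distance [sig] still see a barrier above [M]. *)
Definition barrier sig M k (d : R) : R :=
  M + k * (((sig / 2) ^+ 2)^-1 ^+ N - (d ^+ 2)^-1 ^+ N).

Lemma barrier_ge sig M k d : 0 < sig -> 0 < k -> sig / 2 <= d ->
  M <= barrier sig M k d.
Proof.
move=> s0 k0 sd; have s20 : 0 < sig / 2 by rewrite divr_gt0.
rewrite lerDl mulr_ge0 ?(ltW k0) // subr_ge0; apply: le_invX; first exact: exprn_gt0.
by rewrite lerXn2r // nnegrE ltW // (lt_le_trans s20).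
Qed.

Lemma barrier_le sig M k d e : 0 < k -> 0 < d -> d <= e ->
  barrier sig M k d <= barrier sig M k e.
Proof.
move=> k0 d0 de; rewrite lerD2l ler_wpM2l ?(ltW k0) // lerD2l lerN2.
apply: le_invX; first exact: exprn_gt0.
by rewrite lerXn2r // nnegrE ltW // (lt_le_trans d0).
Qed.

Lemma barrier_continuous z sig M k x : enorm (x - z) != 0 ->
  {for x, continuous (fun x => barrier sig M k (enorm (x - z)))}.
Proof.
move=> xz.
apply: (@continuous_comp _ _ _ (fun x => enorm (x - z)) (barrier sig M k)).
  exact: enorm_continuous.
rewrite /barrier; apply: cvgD; first exact: cvg_cst.
apply: cvgMr; apply: cvgB; first exact: cvg_cst.
apply: (@continuous_comp _ _ _ (fun d : R => (d ^+ 2)^-1) (fun c => c ^+ N));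
  last exact: exprn_continuous.
by apply: cvgV; [rewrite expf_neq0|exact: exprn_continuous].
Qed.

(** The second claim ensures that [F] enters the equation with positive weight only where it is
    controlled. *)
Lemma delta_bounds eps x : 0 < eps -> Omega x ->
  0 <= delta Omega eps x <= 1 /\
  (0 < delta Omega eps x -> Gamma Omega eps x).
Proof.
move=> e0 Ox; rewrite /delta; case: ifPn => [_|xO]; first by rewrite lexx ler01 ltxx.
case: ifPn => [/set_mem xI|xI]; last first.
  by exfalso; move/negP: xO; apply; apply/mem_set; split => // xI'; move/negP: xI; apply; apply/mem_set.
split; last by move=> _; left; exact: subset_closure.
have [_ dx] := xI; have := dist_ge0 x (bdry Omega) => dx0.
rewrite subr_ge0 gerBl mulr_ge0 ?invr_ge0 ?(ltW e0) // andbT.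
by rewrite mulrC ler_pdivrMr // mul1r ltW.
Qed.

(** Suppose u - v has a positive maximum [m], attained at [w]. The outer layer is excluded by [hP],
    and the complement of [Omega] by u = F <= M <= v. So [w] lies in [Omega], where the bound
    [v + m] on all neighbours contradicts the equation. *)
Lemma comparison eps u z sig P M k : 0 < eps <= 1 ->
  is_dpp_solution Omega p F eps u -> 0 < sig -> 2 * eps <= sig -> 0 < P -> 0 < k ->
  (forall x, Omega x -> sig <= enorm (x - z)) ->
  (forall x, Gamma Omega eps x -> enorm (x - z) < P -> F x <= M) ->
  (forall x, closure (enlarged Omega eps) x -> P <= enorm (x - z) <= P + eps ->
     u x <= barrier sig M k P) ->
  forall x, closure (enlarged Omega eps) x -> sig / 2 <= enorm (x - z) < P ->
    u x <= barrier sig M k (enorm (x - z)).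
Proof.
move=> /andP[e0 e1] hu s0 es P0 k0 hz hF hP x Ux /andP[sx xP].
set U := closure (enlarged Omega eps) in hP Ux *.
pose v x := barrier sig M k (enorm (x - z)).
rewrite leNgt; apply/negP => vu.
(* The shell contains all [eps]-steps from points of [Omega] at distance less than [P] from [z]:
   these start at distance at least [sig], and [eps <= sig / 2]. *)
pose K := U `&` (fun x => enorm (x - z)) @^-1` `[sig / 2, P + eps].
have s20 : 0 < sig / 2 by rewrite divr_gt0.
have cK : compact K.
  apply: compact_closedI; first exact: enlarged_compact.
  apply: closed_comp; first by move=> ? _; exact: enorm_continuous.
  exact: interval_closed.
have Kx : K x.
  by split => //; rewrite /= in_itv /= sx /= ltW // (lt_trans xP) ?ltrDl.
have K0 : K !=set0 by exists x.
have [cu hU] := hu.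
have cf : {within K, continuous (fun x => u x - v x)}.
  move=> w; apply: cvgB.
    by apply: (continuous_subspaceW _ cu) w => t [].
  apply: continuous_in_subspaceT w => w /set_mem [_ /=].
  rewrite in_itv /= => /andP[sw _]; apply: barrier_continuous.
  by rewrite gt_eqF // (lt_le_trans s20).
have [w /set_mem Kw hmax] := compact_EVT_max K0 cK cf.
have [m mE] : exists m, m = u w - v w by exists (u w - v w).
have m0 : 0 < m by rewrite mE (lt_le_trans _ (hmax x (mem_set Kx))) ?subr_gt0.
have uK t : K t -> u t <= v t + m.
  by move=> /mem_set /hmax; rewrite -mE lerBlDl addrC.
have [Uw] := Kw; rewrite /= in_itv /= => /andP[sw wPe].
have wP : enorm (w - z) < P.
  rewrite ltNge; apply/negP => Pw; have := hP w Uw; rewrite Pw wPe => /(_ isT) h.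
  have : barrier sig M k P <= v w by exact: barrier_le.
  by lra.
have Mv : M <= v w by exact: barrier_ge.
have [Ow|nOw] := pselect (Omega w); last first.
  have := hF w (enlarged_out_Gamma _ oO eps w e0 Uw nOw) wP.
  by rewrite -(dpp_out _ _ _ _ _ w e0 hu Uw nOw); lra.
have sw2 := hz w Ow.
have [C hC] := compact_continuous_bounded _ _ _ _ (enlarged_compact _ oO bO b0 eps e1) cu.
have [al0 al1 alN] := hp w Ow.
have hC' h : enorm h <= eps -> - C <= u (w + h).
  by move=> he; have := hC _ (enlarged_step _ oO _ _ _ Ow he); rewrite ler_norml => /andP[].
(* Chosen so that [V] minus the power term is exactly [v + m]. *)
pose V := M + m + k * ((sig / 2) ^+ 2)^-1 ^+ N.
have hV h : enorm h <= eps -> u (w + h) <= V - k * (enorm (w + h - z) ^+ 2)^-1 ^+ N.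
  move=> he; have h1 : K (w + h).
    split; first exact: enlarged_step.
    have h1 := ler_enormD (w - z) h; have h2 := ler_enormD (w + h - z) (- h).
    rewrite (addrAC w) addrK enormN in h2; rewrite addrAC in h1.
    rewrite (addrAC w) in h2.
    by rewrite /= in_itv /=; apply/andP; split; lra.
  by have := uK _ h1; rewrite /v /barrier /V; lra.
have ew : eps < enorm (w - z) by lra.
have hSI := W_sup_inf_lt p eps u w z N k V C e0 ew k0 N0 al0 al1 alN hC' hV.
have [/andP[d0 d1] dG] := delta_bounds eps w e0 Ow.
have := hU w Uw; rewrite /dpp_operator mem_set; last exact: subset_closure.
move: hSI; set S := (_ + _); set D := delta _ _ _ => hSI uwE.
have vwE : 2 * (V - k * (enorm (w - z) ^+ 2)^-1 ^+ N) = 2 * (v w + m).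
  by rewrite /V /v /barrier; ring.
rewrite vwE in hSI.
(* If [D] vanishes, [F w] is multiplied by 0 and the contradiction comes from the strict sup-inf
   estimate; otherwise it comes from the loss [D * m] due to F <= M <= v. *)
have [D0|D0] := eqVneq D 0.
  by move: uwE; rewrite D0 mul0r; lra.
have DG : 0 < D by rewrite lt_def D0.
have Fw := hF w (dG DG) wP.
have h1 : (1 - D) / 2 * S <= (1 - D) / 2 * (2 * (v w + m)).
  by rewrite ler_wpM2l ?(ltW hSI) // divr_ge0 // subr_ge0.
have h2 : D * F w <= D * v w by rewrite ler_wpM2l // (le_trans Fw).
have h3 : 0 < D * m by rewrite mulr_gt0.
have h4 : (1 - D) / 2 * (2 * (v w + m)) + D * v w = v w + m - D * m by field.
by lra.
Qed.

(** Beyond [sig / 2] this is comparison and monotonicity of the barrier; closer to [z] the point is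
    outside [Omega], where u = F <= M. *)
Lemma comparison_ball eps u z sig P Q M k : 0 < eps <= 1 ->
  is_dpp_solution Omega p F eps u -> 0 < sig -> 2 * eps <= sig -> 0 < k ->
  sig / 2 <= Q -> Q < P ->
  (forall x, Omega x -> sig <= enorm (x - z)) ->
  (forall x, Gamma Omega eps x -> enorm (x - z) < P -> F x <= M) ->
  (forall x, closure (enlarged Omega eps) x -> P <= enorm (x - z) <= P + eps ->
     u x <= barrier sig M k P) ->
  forall x, closure (enlarged Omega eps) x -> enorm (x - z) <= Q ->
    u x <= barrier sig M k Q.
Proof.
move=> e01 hu s0 es k0 sQ QP hz hF hP x Ux xQ.
have [e0 _] := andP e01; have s20 : 0 < sig / 2 by rewrite divr_gt0.
have [xs|sx] := ltP (enorm (x - z)) (sig / 2); last first.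
  apply: (@le_trans _ _ (barrier sig M k (enorm (x - z)))).
    apply: (comparison eps u z sig P M k) => //; first by lra.
    by rewrite sx (le_lt_trans xQ).
  by apply: barrier_le => //; exact: lt_le_trans sx.
have nO : ~ Omega x by move=> /hz; lra.
rewrite (dpp_out _ _ _ _ _ x e0 hu Ux nO).
apply: le_trans (barrier_ge sig M k Q s0 k0 sQ); apply: hF; last by lra.
exact: enlarged_out_Gamma.
Qed.

End comparison.

(** * Contraction of the boundary oscillation *)

(** As (p - 1) / (p + n) increases with p, the bound inf p > 1 makes [alpha] at least some [a0 > 0];
    since [beta] is at most 1, it suffices that [a0 * N] exceeds 2. *)
Lemma exponent_exists (R : realType) (n : nat) (Omega : set 'rV[R]_n)
    (p : 'rV[R]_n -> R) : Omega !=set0 ->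
  (1 < ereal_inf [set (p x)%:E | x in Omega])%E ->
  exists2 N : nat, (0 < N)%N & forall x, Omega x ->
    [/\ 0 < alpha p x, alpha p x <= 1 & 2 * beta p x < alpha p x * N%:R].
Proof.
move=> [x0 Ox0] hinf.
have [q q1 hq] : exists2 q : R, 1 < q & forall x, Omega x -> q <= p x.
  have hlb x : Omega x -> (ereal_inf [set (p x)%:E | x in Omega] <= (p x)%:E)%E.
    by move=> Ox; apply: ereal_inf_lbound; exists x.
  move: hinf hlb; case: (ereal_inf _) => [q|_ h|//].
    by rewrite lte_fin => q1 h; exists q => // x /h; rewrite lee_fin.
  by have := h x0 Ox0.
have n0 : 0 <= n%:R :> R by [].
have qn : 0 < q + n%:R by lra.
pose a0 := (q - 1) / (q + n%:R).
have a00 : 0 < a0 by rewrite divr_gt0 // subr_gt0.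
pose N := (Num.truncn (2 / a0)).+1.
have hN : 2 < a0 * N%:R.
  by rewrite mulrC -ltr_pdivrMr // /N truncnS_gt.
exists N => // x /hq qp; have pn : 0 < p x + n%:R by lra.
have a0p : a0 <= alpha p x.
  rewrite /a0 /alpha ler_pdivrMr // mulrAC ler_pdivlMr // -subr_ge0.
  have -> : (p x - 1) * (q + n%:R) - (q - 1) * (p x + n%:R) = (p x - q) * (n%:R + 1) by ring.
  by rewrite mulr_ge0 ?subr_ge0 // addr_ge0.
have al0 : 0 < alpha p x by exact: lt_le_trans a0p.
split => //.
  by rewrite /alpha ler_pdivrMr // mul1r; lra.
have : a0 * N%:R <= alpha p x * N%:R by rewrite ler_wpM2r.
by rewrite /beta; lra.
Qed.

Section boundary_estimate.
Context {R : realType} {n : nat}.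
Variables (Omega : set 'rV[R]_n) (p F : 'rV[R]_n -> R) (N : nat) (y : 'rV[R]_n).
Hypotheses (oO : open Omega) (bO : bounded_set Omega) (yb : bdry Omega y).
Hypothesis N0 : (0 < N)%N.
Hypothesis hp : forall x, Omega x ->
  [/\ 0 < alpha p x, alpha p x <= 1 & 2 * beta p x < alpha p x * N%:R].
Variables (eps : R) (u : 'rV[R]_n -> R).
Hypotheses (e01 : 0 < eps <= 1) (hu : is_dpp_solution Omega p F eps u).

Let b0 : bdry Omega !=set0. Proof. by exists y. Qed.

(** The radius [Q] is so large that the layer beyond [Q + 1] misses the enlarged domain, making the
    outer condition vacuous; then the slope [k] tends to 0. *)
Lemma dpp_le_max z sig C : 0 < sig -> 2 * eps <= sig ->
  (forall x, Omega x -> sig <= enorm (x - z)) ->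
  (forall x, Gamma Omega eps x -> F x <= C) ->
  forall x, closure (enlarged Omega eps) x -> u x <= C.
Proof.
move=> s0 es hz hF x Ux.
have [e0 e1] := andP e01.
have [B hB] := enlarged_bounded _ oO bO b0.
have B0 : 0 <= B.
  by apply: le_trans (enorm_ge0 y) (hB eps y e1 _); right; exact: bdry_sub_Gamma.
pose Q := B + enorm z + sig.
have zQ t : closure (enlarged Omega eps) t -> enorm (t - z) <= Q.
  move=> Ut; apply: le_trans (ler_enormD _ _) _; rewrite enormN /Q.
  by have := hB eps t e1 (or_introl Ut); lra.
have Q0 : sig / 2 <= Q by rewrite /Q; have := enorm_ge0 z; lra.
pose A := ((sig / 2) ^+ 2)^-1 ^+ N - (Q ^+ 2)^-1 ^+ N.
have A0 : 0 <= A.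
  have := barrier_ge N sig 0 1 Q s0 ltr01 Q0.
  by rewrite /barrier add0r mul1r.
apply/ler_addgt0Pr => e e0'.
(* With this slope the barrier at [Q] is at most [C + e]; adding 1 avoids dividing by [A], only
   known to be nonnegative. *)
have k0 : 0 < e / (A + 1) by rewrite divr_gt0 //; lra.
have hP t : closure (enlarged Omega eps) t ->
    Q + 1 <= enorm (t - z) <= Q + 1 + eps -> u t <= barrier N sig C (e / (A + 1)) (Q + 1).
  by move=> Ut /andP[h _]; have := zQ t Ut; lra.
have QQ : Q < Q + 1 by rewrite ltrDl.
have h := comparison_ball Omega p F N oO bO b0 N0 hp eps u z sig (Q + 1) Q C _ e01 hu
  s0 es k0 Q0 QQ hz (fun t Gt _ => hF t Gt) hP x Ux (zQ x Ux).
apply: (le_trans h); rewrite /barrier lerD2l -/A mulrAC ler_pdivrMr; last by lra.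
by rewrite ler_wpM2l ?(ltW e0') // lerDl.
Qed.

Variables (r s : R).
Hypotheses (r_gt0 : 0 < r) (s01 : 0 < s < 1) (hreg : boundary_regularity Omega r s).

Let g (c : R) : R := (c ^+ 2)^-1 ^+ N.

(** Ratio of the barrier excess over [M] at distance 2 rho to that at 3 rho, for [sig = s * rho]. By
    homogeneity rho cancels. *)
Definition contraction : R := (g (s / 2) - g 2) / (g (s / 2) - g 3).

Lemma contraction_itv : 0 < contraction < 1.
Proof.
have [s0 s1] := andP s01.
have s20 : 0 < s / 2 by rewrite divr_gt0.
have h1 : g 2 < g (s / 2).
  by apply: lt_invX; [|exact: exprn_gt0|rewrite ltrXn2r ?nnegrE ?(ltW s20) //; lra].
have h2 : g 3 < g 2.
  by apply: lt_invX; [|exact: exprn_gt0|rewrite ltrXn2r ?nnegrE //; lra].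
by rewrite divr_gt0 ?ltr_pdivrMr //; lra.
Qed.

(** Since |z - y| < rho, the ball of radius rho about [y] lies within 2 rho of [z], and the points
    within 3 rho + eps of [z] lie within 5 rho of [y], as eps < rho. *)
Lemma oscillation_step rho M L : 0 < rho <= r -> 2 * eps <= s * rho -> 0 < L ->
  (forall x, Gamma Omega eps x -> eball y (5 * rho) x -> F x <= M) ->
  (forall x, closure (enlarged Omega eps) x -> eball y (5 * rho) x -> u x <= M + L) ->
  forall x, closure (enlarged Omega eps) x -> eball y rho x ->
    u x <= M + contraction * L.
Proof.
move=> rhor es L0 hF hL x Ux xy.
have [s0 s1] := andP s01; have [rho0 _] := andP rhor; have [e0 e1] := andP e01.
have [z [[zy _] hz]] := hreg rho y rhor yb.
have sr : s * rho < rho by rewrite gtr_pMl.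
have zy' t : enorm (t - y) <= enorm (t - z) + enorm (z - y) by exact: ler_enormBD.
rewrite /eball /= in zy xy.
have Oz t : Omega t -> s * rho <= enorm (t - z).
  by move=> Ot; rewrite leNgt; apply/negP => /hz [_].
have gE c : ((c * rho) ^+ 2)^-1 ^+ N = g c * g rho.
  by rewrite /g -exprMn -invfM exprMn.
have g3 : g 3 < g (s / 2).
  have s20 : 0 < s / 2 by rewrite divr_gt0.
  by apply: lt_invX => //; [exact: exprn_gt0|rewrite ltrXn2r ?nnegrE ?(ltW s20) //; lra].
have grho : 0 < g rho by rewrite /g exprn_gt0 // invr_gt0 exprn_gt0.
(* This slope makes the barrier equal [M + L] at distance 3 rho. *)
pose k := L / ((g (s / 2) - g 3) * g rho).
have k0 : 0 < k by rewrite divr_gt0 // mulr_gt0 ?subr_gt0.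
have sE : s * rho / 2 = s / 2 * rho by rewrite mulrAC.
have g3n : g (s / 2) - g 3 != 0 by rewrite subr_eq0 gt_eqF.
have b3 : barrier N (s * rho) M k (3 * rho) = M + L.
  by rewrite /barrier sE !gE /k; field; rewrite g3n gt_eqF.
have b2 : barrier N (s * rho) M k (2 * rho) = M + contraction * L.
  by rewrite /barrier sE !gE /k /contraction; field; rewrite g3n gt_eqF.
rewrite -b2; apply: (comparison_ball Omega p F N oO bO b0 N0 hp eps u z (s * rho) (3 * rho)
  (2 * rho) M k e01 hu) => //.
- by rewrite mulr_gt0.
- by lra.
- by lra.
- by move=> t Gt tz; apply: hF => //; rewrite /eball /=; have := zy' t; lra.
- move=> t Ut /andP[_ tz]; rewrite b3; apply: hL => //; rewrite /eball /=.
  by have := zy' t; lra.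
- by have := ler_enormBD x y z; rewrite (enormB y z); lra.
Qed.

(** Smallness of [eps] is imposed at the finest scale only, since it implies the condition at all
    coarser ones. *)
Lemma oscillation_iter j M L : 2 * eps <= s * (r / 5 ^+ j) -> 0 < L ->
  (forall x, Gamma Omega eps x -> eball y r x -> F x <= M) ->
  (forall x, closure (enlarged Omega eps) x -> eball y r x -> u x <= M + L) ->
  forall x, closure (enlarged Omega eps) x -> eball y (r / 5 ^+ j) x ->
    u x <= M + contraction ^+ j * L.
Proof.
move=> + L0 hF hL; have [s0 s1] := andP s01.
have [c0 c1] := andP contraction_itv.
elim: j => [|j IH] es x Ux.
  by rewrite !expr0 mul1r divr1; exact: hL.
pose rho := r / 5 ^+ j.+1.
have rho0 : 0 < rho by rewrite divr_gt0 ?exprn_gt0.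
have rho5 : r / 5 ^+ j = 5 * rho.
  by rewrite /rho exprS; field; rewrite expf_neq0.
have rhor : 5 * rho <= r.
  by rewrite -rho5 ler_pdivrMr ?exprn_gt0 // ler_peMr ?(ltW r_gt0) // exprn_ege1 // ler1n.
rewrite rho5 in IH.
have es5 : 2 * eps <= s * (5 * rho).
  by apply: le_trans es _; rewrite -/rho ler_pM2l // ler_peMl ?(ltW rho0) // ler1n.
rewrite -/rho => xr; rewrite exprS -mulrA.
apply: (oscillation_step rho M (contraction ^+ j * L)) => //.
- by rewrite rho0 /=; lra.
- by rewrite mulr_gt0 ?exprn_gt0.
- by move=> t Gt yt; apply: hF => //; exact: lt_le_trans yt rhor.
- by move=> t Ut yt; exact: IH.
Qed.

End boundary_estimate.

(** Bernoulli applied to the inverse of [c], whose powers thus grow at least linearly. *)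
Lemma exists_expr_lt (R : realType) (c x : R) : 0 < c < 1 -> 0 < x ->
  exists j, c ^+ j < x.
Proof.
move=> /andP[c0 c1] x0.
have ci : 0 < c^-1 - 1 by rewrite subr_gt0 invf_gt1.
pose j := (Num.truncn (x^-1 / (c^-1 - 1))).+1.
have hj : x^-1 / (c^-1 - 1) < j%:R by exact: truncnS_gt.
exists j; rewrite -[c]invrK exprVn -[x]invrK ltf_pV2 ?posrE ?invr_gt0 ?exprn_gt0 ?invr_gt0 //.
have := bernoulli c^-1 j ltac:(by rewrite invr_ge0 ltW).
by move: hj; rewrite ltr_pdivrMr //; lra.
Qed.

(** * Choice of the number of scales and of the threshold on [eps] *)

Theorem theorem5p2 (R : realType) (n : nat) (hn : (2 <= n)%N)
  (Omega : set 'rV[R]_n) (hOmega : bounded_domain Omega)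
  (p : 'rV[R]_n -> R)
  (hp : {within closure Omega, continuous p})
  (hp_inf : (1 < ereal_inf [set (p x)%:E | x in Omega])%E)
  (hp_sup : (ereal_sup [set (p x)%:E | x in Omega] < +oo)%E)
  (F : 'rV[R]_n -> R)
  (hF : {within Gamma Omega 1, continuous F})
  (r0 s : R) (hr0 : 0 < r0 < 1) (hs : 0 < s < 1)
  (hreg : boundary_regularity Omega r0 s)
  (y : 'rV[R]_n) (hy : bdry Omega y)
  (r : R) (hr : 0 < r <= r0)
  (z : 'rV[R]_n) (hz : regularity_ball Omega s r y z)
  (u : R -> 'rV[R]_n -> R)
  (hu : forall eps, 0 < eps < 1 -> is_dpp_solution Omega p F eps (u eps)) :
  forall eta : R, 0 < eta ->
    exists (eps0 : R) (k : nat), [/\ 0 < eps0 < 1, (1 <= k)%N &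
      forall (eps : R) (x0 : 'rV[R]_n),
        0 < eps < eps0 ->
        (eball y (4 ^ (1 - k%:Z) * r) `&` closure (enlarged Omega eps)) x0 ->
        u eps x0 - sup [set F x | x in eball z (4 * r) `&` Gamma Omega eps]
          < eta].
Proof.
move=> eta eta0.
have [ne oO _ bO] := hOmega.
have [s0 s1] := andP hs; have [rgt0 rr0] := andP hr.
have [[yz _] hz'] := hz; rewrite /eball /= in yz.
have [N N0 hN] := exponent_exists _ _ _ _ ne hp_inf.
have b0 : bdry Omega !=set0 by exists y.
have [C hC] := compact_continuous_bounded _ _ _ _ (Gamma_compact _ oO bO b0 1 (lexx 1)) hF.
have C0 : 0 <= C.
  by apply: le_trans (normr_ge0 (F y)) (hC y _); exact: bdry_sub_Gamma.
have hregr : boundary_regularity Omega r s.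
  by move=> t w /andP[t0 tr]; apply: hreg; rewrite t0 (le_trans tr).
(* From [u <= C] and [- C <= M] follows [u <= M + 2 * C]; the extra 1 keeps [L] positive when [C] is
   0. *)
pose L := 2 * C + 1; have L0 : 0 < L by rewrite /L; lra.
have c01 := contraction_itv N N0 s hs.
have [j hj] := exists_expr_lt _ _ (eta / L) c01 ltac:(by rewrite divr_gt0).
rewrite ltr_pdivlMr // in hj.
pose rj := r / 5 ^+ j.
have rj0 : 0 < rj by rewrite divr_gt0 ?exprn_gt0.
have rjr : rj <= r by rewrite ler_pdivrMr ?exprn_gt0 // ler_peMr ?(ltW rgt0) // exprn_ege1 // ler1n.
have srj : s * rj <= s * r by rewrite ler_pM2l.
(* The threshold gives [2 * eps <= s * rj]. With k = 2j + 1 the radius 4^(1-k) r is r / 16^j, which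
   is at most r / 5^j. *)
exists (Num.min (1 / 2) (s * rj / 2)), (2 * j).+1; split => //.
  by rewrite lt_min gt_min divr_gt0 // divr_gt0 ?mulr_gt0 //=; apply/orP; left; lra.
move=> eps x0 /andP[e0]; rewrite lt_min => /andP[e1 ej] [x0y Ux0].
have e01 : 0 < eps <= 1 by rewrite e0 /=; lra.
have hue : is_dpp_solution Omega p F eps (u eps) by apply: hu; rewrite e0 /=; lra.
have GC x : Gamma Omega eps x -> `|F x| <= C.
  by move=> Gx; apply: hC; apply: Gamma_le Gx; lra.
set M := sup _.
have yG : Gamma Omega eps y by exact: bdry_sub_Gamma.
(* As |y - z| < r, the ball of radius r about [y], where the iteration starts, lies in the ball over
   which the supremum [M] is taken. *)
have rz t : enorm (t - y) < r -> eball z (4 * r) t.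
  by rewrite /eball /= => ty; have := ler_enormBD t y z; rewrite (enormB y z); lra.
have ubM : has_ubound [set F x | x in eball z (4 * r) `&` Gamma Omega eps].
  by exists C => _ [x [_ /GC]] + <-; rewrite ler_norml => /andP[].
have FM x : Gamma Omega eps x -> eball y r x -> F x <= M.
  by move=> Gx xy; apply: ub_le_sup => //; exists x => //; split => //; exact: rz.
have MC : - C <= M.
  apply: (@le_trans _ _ (F y)); first by have := GC y yG; rewrite ler_norml => /andP[].
  by apply: FM => //; rewrite /eball /= subrr enorm0.
have uC x : closure (enlarged Omega eps) x -> u eps x <= C.
  apply: (dpp_le_max Omega p F N y oO bO hy N0 hN eps (u eps) e01 hue z (s * r)).
  - by rewrite mulr_gt0.
  - by lra.
  - by move=> t Ot; rewrite leNgt; apply/negP => /hz' [_].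
  - by move=> t /GC; rewrite ler_norml => /andP[].
have hx : eball y (r / 5 ^+ j) x0.
  apply: lt_le_trans x0y _; rewrite mulrC ler_pM2l //.
  rewrite intS opprD addrA subrr sub0r -exprnN lef_pV2 ?posrE ?exprn_gt0 // exprM lerXn2r ?nnegrE //.
  by rewrite -natrX ler_nat.
have := oscillation_iter Omega p F N y oO bO hy N0 hN eps (u eps) e01 hue r s rgt0 hs
  hregr j M L ltac:(rewrite -/rj; lra) L0 FM
  (fun x Ux _ => ltac:(by have := uC x Ux; rewrite /L; lra)) x0 Ux0 hx.
by lra.
Qed.
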